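(* Let $\pi^*$ be a self-inverting permutation of length $N$ which is the output of the algorithm Encode\_W-to-SIP on a positive integer $w$. Then the algorithm Decode\_SIP-to-W (described in the context), applied to $\pi^*$, outputs $w$, and it runs in $O(N)$ time and $O(N)$ space.
   Context: A permutation $\pi=(\pi_1,\ldots,\pi_m)$ of $\{1,\ldots,m\}$ is self-inverting if $\pi_{\pi_i}=i$ for all $i$; its cycles then have length 1 or 2. For a binary string $B$, $\mathrm{flip}(B)$ complements every bit; $\|$ is concatenation. Algorithm Encode\_W-to-SIP on a positive integer $w$: let $B=b_1\cdots b_n$ be the binary representation of $w$; let $B'=0^n\|B\|1$ (length $n'=2n+1$) and $B^*=\mathrm{flip}(B')$; let $X=(x_1<\cdots<x_k)$ be the positions of 0's and $Y=(y_1<\cdots<y_m)$ the positions of 1's in $B^*$; let $\pi^b=(x_1,\ldots,x_k,y_m,\ldots,y_1)$; output the involution $\pi^*$ of $\{1,\ldots,n'\}$ whose cycles are the 2-cycles $(\pi^b_i,\pi^b_{n'+1-i})$, $1\le i\le n$, and the 1-cycle $(\pi^b_{n+1})$. Algorithm Decode\_SIP-to-W on an involution $\pi^*$ of $\{1,\ldots,n'\}$, $n'=2n+1$: (1) compute the increasing cycle representation of $\pi^*$: list its cycles, each 2-cycle written $(a,b)$ with $a<b$ and each 1-cycle as $(a)$, in increasing order of their first (smallest) element; (2)–(3) set $i=1$, $j=n'$ and build a sequence $\pi=(\pi_1,\ldots,\pi_{n'})$ by processing the cycles in this order: for a 2-cycle $(a,b)$ set $\pi_i=b$, $\pi_j=a$,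 $i\leftarrow i+1$, $j\leftarrow j-1$; for a 1-cycle $(a)$ set $\pi_i=a$, $i\leftarrow i+1$; (4) let $(\pi_1,\ldots,\pi_k)$ be the maximal initial increasing run of $\pi$ (so $\pi_k>\pi_{k+1}$) and $(\pi_{k+1},\ldots,\pi_{n'})$ the rest; (5) build the bit sequence $B^*$ of length $n'$ with 0's at positions $\pi_1,\ldots,\pi_k$ and 1's at positions $\pi_{k+1},\ldots,\pi_{n'}$; (6) compute $\mathrm{flip}(B^* )=c_1c_2\cdots c_{n'}$; (7) return the integer whose binary representation is $c_{n+1}c_{n+2}\cdots c_{n'-1}$. *)

(* Defs.v *)
From mathcomp Require Import all_boot.

Set Implicit Arguments.
Unset Strict Implicit.
Unset Printing Implicit Defensive.

(* A permutation of {1,...,N} is its one-line notation, a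
   sequence of naturals.  All indices, positions and values are 1-based. *)
Definition entry (T : Type) (x0 : T) (s : seq T) (i : nat) : T := nth x0 s i.-1.
Definition position (s : seq nat) (v : nat) : nat := (index v s).+1.

Definition self_inverting (N : nat) (p : seq nat) : Prop :=
  perm_eq p (iota 1 N) /\
  forall i, 1 <= i <= N -> entry 0 p (entry 0 p i) = i.

(* Most significant bit first, without leading zeros when 0 < w. *)
Definition binary (w : nat) : seq bool :=
  [seq odd (w %/ 2 ^ i) | i <- rev (iota 0 (trunc_log 2 w).+1)].
Definition binary_value (b : seq bool) : nat :=
  foldl (fun acc c => 2 * acc + nat_of_bool c) 0 b.

Definition flip (b : seq bool) : seq bool := map negb b.
Definition positions_of (c : bool) (b : seq bool) : seq nat :=
  [seq i <- iota 1 (size b) | entry false b i == c].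

(** * Encode_W-to-SIP *)

(* The involution whose cycles pair pb_i with pb_{N+1-i}, where N = size pb;
   for N odd the middle entry is its fixed point. *)
Definition involution_of (pb : seq nat) : seq nat :=
  [seq entry 0 pb ((size pb).+1 - position pb v) | v <- iota 1 (size pb)].

Definition encode_bits (w : nat) : seq bool :=
  let B := binary w in flip (nseq (size B) false ++ B ++ [:: true]).
Definition bitonic_perm (w : nat) : seq nat :=
  let Bs := encode_bits w in
  positions_of false Bs ++ rev (positions_of true Bs).
Definition encode_W_to_SIP (w : nat) : seq nat := involution_of (bitonic_perm w).

Lemma size_binary w : size (binary w) = (trunc_log 2 w).+1.
Proof. by rewrite size_map size_rev size_iota. Qed.

Lemma size_encode_bits w : size (encode_bits w) = (size (binary w)).*2.+1.
Proof.
by rewrite /encode_bits size_map !size_cat size_nseq addn1 addnS addnn.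
Qed.

Lemma bitonic_perm_perm w :
  perm_eq (bitonic_perm w) (iota 1 (size (encode_bits w))).
Proof.
rewrite /bitonic_perm /positions_of; set b := encode_bits w.
rewrite perm_sym -(perm_filterC [pred i | entry false b i == false]).
rewrite perm_cat2l perm_sym perm_rev.
suff -> : [seq i <- iota 1 (size b) | entry false b i == true] =
          filter (predC [pred i | entry false b i == false]) (iota 1 (size b)) by [].
apply: eq_filter => i /=.
by case: (entry _ _ _).
Qed.

Lemma size_bitonic_perm w : size (bitonic_perm w) = (size (binary w)).*2.+1.
Proof.
by rewrite (perm_size (bitonic_perm_perm w)) size_iota size_encode_bits.
Qed.

Lemma size_encode w : size (encode_W_to_SIP w) = (size (binary w)).*2.+1.
Proof. by rewrite size_map size_iota size_bitonic_perm. Qed.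

Lemma involution_of_cycles pb i :
  perm_eq pb (iota 1 (size pb)) -> 1 <= i <= size pb ->
  entry 0 (involution_of pb) (entry 0 pb i) = entry 0 pb ((size pb).+1 - i).
Proof.
move=> pb_perm /andP[i_gt0 le_iN].
have lt_i : i.-1 < size pb by rewrite prednK.
have uniq_pb : uniq pb by rewrite (perm_uniq pb_perm) iota_uniq.
have := mem_nth 0 lt_i; rewrite (perm_mem pb_perm) mem_iota add1n ltnS.
rewrite -/(entry 0 pb i) => /andP[v_gt0 le_vN].
have lt_v : (entry 0 pb i).-1 < size pb by rewrite prednK.
rewrite [LHS]/entry (nth_map 0) ?size_iota // nth_iota // add1n prednK //.
by rewrite /position index_uniq // prednK.
Qed.

Lemma involution_of_self_inverting pb :
  perm_eq pb (iota 1 (size pb)) -> self_inverting (size pb) (involution_of pb).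
Proof.
move=> pb_perm; have pbE v : (v \in pb) = (1 <= v <= size pb).
  by rewrite (perm_mem pb_perm) mem_iota add1n ltnS.
have inv v : 1 <= v <= size pb ->
    entry 0 (involution_of pb) (entry 0 (involution_of pb) v) = v.
  rewrite -pbE => v_pb; have lt_iv : index v pb < size pb by rewrite index_mem.
  have ev : entry 0 pb (position pb v) = v by rewrite /entry nth_index.
  have iv : 1 <= position pb v <= size pb by [].
  rewrite -[in LHS]ev (involution_of_cycles pb_perm iv).
  rewrite (involution_of_cycles pb_perm); last by rewrite /position subSS subn_gt0 lt_iv leq_subr.
  by rewrite subKn // ltnW.
split=> //; have sub : {subset involution_of pb <= iota 1 (size pb)}.
  move=> x /mapP[v]; rewrite mem_iota add1n ltnS -pbE => v_pb ->.
  rewrite -(perm_mem pb_perm) mem_nth // /position subSS.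
  by rewrite prednK ?leq_subr // subn_gt0 index_mem.
have sz : size (involution_of pb) = size pb by rewrite size_map size_iota.
have uniq_e : uniq (involution_of pb).
  apply/(uniqP 0) => i j; rewrite !inE sz => lt_i lt_j eq_ij.
  have [] : i.+1 = j.+1 by rewrite -(inv i.+1) // -(inv j.+1) // /entry /= eq_ij.
  by [].
rewrite uniq_perm ?iota_uniq //; apply: (uniq_min_size uniq_e sub _).2.
by rewrite size_iota sz.
Qed.

Lemma encode_self_inverting w :
  self_inverting (size (encode_W_to_SIP w)) (encode_W_to_SIP w).
Proof.
rewrite size_encode -size_bitonic_perm; apply: involution_of_self_inverting.
by rewrite size_bitonic_perm -size_encode_bits bitonic_perm_perm.
Qed.

(** * Decode_SIP-to-W *)

Definition increasing_cycles (p : seq nat) : seq (seq nat) :=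
  [seq (if entry 0 p a == a then [:: a] else [:: a; entry 0 p a])
  | a <- iota 1 (size p) & a <= entry 0 p a].

Definition set_entry (s : seq nat) (i v : nat) : seq nat := set_nth 0 s i.-1 v.

Definition process_cycle (st : nat * nat * seq nat) (c : seq nat) :=
  let: (i, j, q) := st in
  match c with
  | [:: a; b] => (i.+1, j.-1, set_entry (set_entry q i b) j a)
  | [:: a] => (i.+1, j, set_entry q i a)
  | _ => st
  end.
Definition unfold_cycles (N : nat) (cs : seq (seq nat)) : seq nat :=
  (foldl process_cycle (1, N, nseq N 0) cs).2.

Fixpoint increasing_run (s : seq nat) : seq nat :=
  match s with
  | x :: ((y :: _) as s') => if x < y then x :: increasing_run s' else [:: x]
  | _ => s
  end.

Definition decode_bits (q : seq nat) : seq bool :=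
  let rest := drop (size (increasing_run q)) q in
  [seq i \in rest | i <- iota 1 (size q)].

Definition decode_SIP_to_W (p : seq nat) : nat :=
  let n := (size p)./2 in
  let q := unfold_cycles (size p) (increasing_cycles p) in
  let c := flip (decode_bits q) in
  binary_value (take n (drop n c)).

(** * A word RAM *)

(* Time and space are those of a random access machine with finitely many
   registers and arrays (1-based, zero-filled when allocated).  Each operation
   on words costs one unit of time, allocating an array of length v costs v
   more, and the space of a state is its number of memory cells, the input
   array included.  Every word handled must be smaller than W:
   an execution that overflows W, or that accesses an array out of bounds, is
   stuck.  With W = O(N) a cell holds O(log N) bits. *)
Inductive reg := Reg of nat.
Inductive arr := Arr of nat.
Definition reg_id (x : reg) : nat := let: Reg k := x in k.
Definition arr_id (a : arr) : nat := let: Arr k := a in k.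

Inductive binop := Add | Sub | Leq | Ltn.
Inductive expr :=
  | Lit of nat
  | Var of reg
  | Length of arr
  | Read of arr & expr
  | Half of expr
  | Op of binop & expr & expr
  | AndThen of expr & expr.   (* lazy conjunction; 0 is false *)

Inductive cmd :=
  | Skip
  | Assign of reg & expr
  | Alloc of arr & expr
  | Write of arr & expr & expr
  | Seq of cmd & cmd
  | If of expr & cmd & cmd
  | While of expr & cmd.

Record state := State { regs : seq nat; arrs : seq (seq nat) }.
Definition get_reg (s : state) (x : reg) : nat := nth 0 (regs s) (reg_id x).
Definition get_arr (s : state) (a : arr) : seq nat := nth [::] (arrs s) (arr_id a).
Definition set_reg (s : state) (x : reg) (v : nat) : state :=
  State (set_nth 0 (regs s) (reg_id x) v) (arrs s).
Definition set_arr (s : state) (a : arr) (t : seq nat) : state :=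
  State (regs s) (set_nth [::] (arrs s) (arr_id a) t).
Definition space (s : state) : nat := size (regs s) + sumn (map size (arrs s)).

Definition op_eval (o : binop) (u v : nat) : nat :=
  match o with
  | Add => u + v
  | Sub => u - v
  | Leq => u <= v
  | Ltn => u < v
  end.

Definition word (W v t : nat) : option (nat * nat) :=
  if v < W then Some (v, t) else None.

(* Value of an expression, with the time taken to evaluate it. *)
Fixpoint eval (W : nat) (s : state) (e : expr) : option (nat * nat) :=
  match e with
  | Lit v => word W v 1
  | Var x => word W (get_reg s x) 1
  | Length a => word W (size (get_arr s a)) 1
  | Read a e =>
      if eval W s e is Some (i, t) then
        if 1 <= i <= size (get_arr s a)
        then word W (entry 0 (get_arr s a) i) t.+1 else None
      else None
  | Half e => if eval W s e is Some (v, t) then word W v./2 t.+1 else None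
  | Op o e1 e2 =>
      if eval W s e1 is Some (v1, t1) then
        if eval W s e2 is Some (v2, t2) then
          word W (op_eval o v1 v2) (t1 + t2).+1
        else None
      else None
  | AndThen e1 e2 =>
      if eval W s e1 is Some (v1, t1) then
        if v1 == 0 then word W 0 t1.+1 else
        if eval W s e2 is Some (v2, t2) then word W v2 (t1 + t2).+1 else None
      else None
  end.

(* exec W c s s' t m: from state s, the command c halts in state s' after time
   t, and m is the largest space of a state met on the way. *)
Inductive exec (W : nat) : cmd -> state -> state -> nat -> nat -> Prop :=
  | ExecSkip s : exec W Skip s s 1 (space s)
  | ExecAssign x e s v t :
      eval W s e = Some (v, t) ->
      let s' := set_reg s x v in
      exec W (Assign x e) s s' t.+1 (maxn (space s) (space s'))
  | ExecAlloc a e s v t :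
      eval W s e = Some (v, t) ->
      let s' := set_arr s a (nseq v 0) in
      exec W (Alloc a e) s s' (t + v).+1 (maxn (space s) (space s'))
  | ExecWrite a e1 e2 s i v t1 t2 :
      eval W s e1 = Some (i, t1) -> eval W s e2 = Some (v, t2) ->
      1 <= i <= size (get_arr s a) ->
      let s' := set_arr s a (set_entry (get_arr s a) i v) in
      exec W (Write a e1 e2) s s' (t1 + t2).+1 (maxn (space s) (space s'))
  | ExecSeq c1 c2 s s1 s2 t1 t2 m1 m2 :
      exec W c1 s s1 t1 m1 -> exec W c2 s1 s2 t2 m2 ->
      exec W (Seq c1 c2) s s2 (t1 + t2) (maxn m1 m2)
  | ExecIf e c1 c2 s s' v t t' m :
      eval W s e = Some (v, t) -> exec W (if v == 0 then c2 else c1) s s' t' m ->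
      exec W (If e c1 c2) s s' (t + t').+1 m
  | ExecWhileEnd e c s t :
      eval W s e = Some (0, t) -> exec W (While e c) s s t.+1 (space s)
  | ExecWhileStep e c s s1 s2 v t t1 t2 m1 m2 :
      eval W s e = Some (v, t) -> v != 0 ->
      exec W c s s1 t1 m1 -> exec W (While e c) s1 s2 t2 m2 ->
      exec W (While e c) s s2 (t + t1 + t2).+1 (maxn m1 m2).

Lemma exec_deterministic W c s s1 s2 t1 t2 m1 m2 :
  exec W c s s1 t1 m1 -> exec W c s s2 t2 m2 ->
  [/\ s1 = s2, t1 = t2 & m1 = m2].
Proof.
move=> run1; elim: run1 s2 t2 m2 => {c s s1 t1 m1};
  intros; match goal with run2 : exec _ _ _ ?s2 ?t2 ?m2 |- [/\ _ = ?s2, _ & _] =>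
    inversion run2; clear run2 end; subst;
  repeat match goal with
  | ev1 : eval ?W ?s ?e = Some _, ev2 : eval ?W ?s ?e = Some _ |- _ =>
      rewrite ev1 in ev2; injection ev2 as; subst
  | IH : forall s2 t2 m2, exec ?W ?c ?s s2 t2 m2 -> _, run : exec ?W ?c ?s _ _ _ |- _ =>
      case: (IH _ _ _ run) => ? ? ?; clear IH; subst
  end; by [].
Qed.

(** * Decode_SIP-to-W as a program of the word RAM *)

Coercion Lit : nat >-> expr.
Coercion Var : reg >-> expr.

Declare Scope ram_scope.
Delimit Scope ram_scope with ram.
Bind Scope ram_scope with expr.
Bind Scope ram_scope with cmd.
Notation "e1 + e2" := (Op Add e1 e2) : ram_scope.
Notation "e1 - e2" := (Op Sub e1 e2) : ram_scope.
Notation "e1 <= e2" := (Op Leq e1 e2) : ram_scope.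
Notation "e1 < e2" := (Op Ltn e1 e2) : ram_scope.
Notation "e1 && e2" := (AndThen e1 e2) : ram_scope.
Notation "x ::= e" := (Assign x e) (at level 75) : ram_scope.
Notation "c1 ;; c2" := (Seq c1 c2) (at level 85, right associativity) : ram_scope.

Definition For (x : reg) (e1 e2 : expr) (c : cmd) : cmd :=
  (x ::= e1 ;; While (x <= e2) (c ;; x ::= x + 1))%ram.

Section Program.
Local Open Scope ram_scope.

Definition input_array : arr := Arr 0.
Definition output_array : arr := Arr 1.
Let P := input_array.
Let Out := output_array.
Let First := Arr 2.   (* the smaller and the larger element of the l-th cycle, *)
Let Second := Arr 3.  (* equal for a 1-cycle *)
Let Q := Arr 4.
Let Bs := Arr 5.
Let C := Arr 6.
Let N := Reg 0.
Let n := Reg 1.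
Let a := Reg 2.
Let cycles := Reg 3.
Let l := Reg 4.
Let i := Reg 5.
Let j := Reg 6.
Let k := Reg 7.
Let r := Reg 8.

Definition prog_cycles : cmd :=
  Alloc First N ;; Alloc Second N ;; cycles ::= 0 ;;
  For a 1 N
    (If (a <= Read P a)
       (cycles ::= cycles + 1 ;; Write First cycles a ;;
        Write Second cycles (Read P a))
       Skip).

Definition prog_unfold : cmd :=
  Alloc Q N ;; i ::= 1 ;; j ::= N ;;
  For l 1 cycles
    (If (Read First l < Read Second l)
       (Write Q i (Read Second l) ;; Write Q j (Read First l) ;;
        i ::= i + 1 ;; j ::= j - 1)
       (Write Q i (Read First l) ;; i ::= i + 1)).

Definition prog_run : cmd :=
  k ::= 1 ;;
  While ((k < N) && (Read Q k < Read Q (k + 1))) (k ::= k + 1).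

Definition prog_bits : cmd :=
  Alloc Bs N ;;
  For r 1 k (Write Bs (Read Q r) 0) ;;
  For r (k + 1) N (Write Bs (Read Q r) 1).

Definition prog_flip : cmd :=
  Alloc C N ;; For r 1 N (Write C r (1 - Read Bs r)).

Definition prog_return : cmd :=
  Alloc Out n ;; For r 1 n (Write Out r (Read C (n + r))).

Definition decode_program : cmd :=
  N ::= Length P ;; n ::= Half N ;;
  prog_cycles ;; prog_unfold ;; prog_run ;; prog_bits ;; prog_flip ;; prog_return.

End Program.

Definition initial_state (p : seq nat) : state := State [::] [:: p].

(* An integer too large for one word is returned as the array of its binary
   digits, most significant first. *)
Definition returns (s : state) (w : nat) : Prop :=
  get_arr s output_array = [seq nat_of_bool b | b <- binary w].

(* Main.v *)
Require Import Defs.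
From mathcomp Require Import all_boot zify.

(** The last [n] entries of the bitonic permutation [q] are [n, ..., 1], and all
    others exceed [n].  So the cycles of the involution are [(a, q_a)] for
    [a <= n] and the fixed point [q_{n+1}], whose leader exceeds [n]: unfolding
    them in increasing order of their leaders rebuilds [q].  The last zero of
    [B*] is at position [N], so the increasing run of [q] stops exactly there,
    and the bits of [w] can be read off.

    The loops of the RAM program have loop-free bodies, on which execution is
    computed by a total function; the explicit state reached at each iteration
    serves as loop invariant.  An instruction enlarges the memory by at most a
    constant times its own running time, so linear time implies linear space. *)

Set Implicit Arguments.
Unset Strict Implicit.
Unset Printing Implicit Defensive.

(** * Arrays as tables of functions on 1-based indices; binary digits *)

Definition table (N : nat) (f : nat -> nat) : seq nat :=
  [seq f i | i <- iota 1 N].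

Lemma size_table N f : size (table N f) = N.
Proof. by rewrite size_map size_iota. Qed.

Lemma entry_table N f i : 0 < i <= N -> entry 0 (table N f) i = f i.
Proof.
case: i => // i lt_iN.
by rewrite /entry (nth_map 0) ?size_iota ?nth_iota.
Qed.

Lemma eq_table N f g :
  (forall i, 0 < i <= N -> f i = g i) -> table N f = table N g.
Proof. by move=> eq_fg; apply/eq_in_map => i; rewrite mem_iota => /eq_fg. Qed.

Lemma set_entry_table N f i v : 0 < i <= N ->
  set_entry (table N f) i v = table N (fun j => if j == i then v else f j).
Proof.
case: i => // i lt_iN; apply: (@eq_from_nth _ 0) => [|j].
  by rewrite size_set_nth !size_table; apply/maxn_idPr.
rewrite size_set_nth size_table (maxn_idPr lt_iN) => lt_jN.
by rewrite nth_set_nth /= !(nth_map 0) ?size_iota // nth_iota.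
Qed.

Lemma table_entry (s : seq nat) : s = table (size s) (entry 0 s).
Proof.
apply: (@eq_from_nth _ 0); first by rewrite size_table.
by move=> j lt_js; rewrite (nth_map 0) ?size_iota ?nth_iota.
Qed.

Lemma nseq_table N : nseq N 0 = table N (fun=> 0).
Proof.
apply: (@eq_from_nth _ 0) => [|j]; rewrite size_nseq ?size_table // => lt_jN.
by rewrite nth_nseq lt_jN (nth_map 0) ?size_iota.
Qed.

Lemma binary_valueK w : binary_value (binary w) = w.
Proof.
(* The width [m] is free, so that induction on it can halve [v]. Digit 0 comes last in the list,
   hence the fold ends by forming [2 * v./2 + odd v]. *)
have value_digits m v : v < 2 ^ m ->
    binary_value [seq odd (v %/ 2 ^ i) | i <- rev (iota 0 m)] = v.
  elim: m v => [|m IHm] v; first by case: v.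
  rewrite expnS => lt_v; rewrite -[m.+1]add1n iotaD rev_cat map_cat /=.
  rewrite /binary_value foldl_cat /= (iotaDl 1) -map_rev -map_comp.
  rewrite (eq_map (g := fun i => odd (v./2 %/ 2 ^ i))) => [|i /=]; last first.
    by rewrite expnS divnMA divn2.
  rewrite -/(binary_value _) IHm ?divn1; lia.
by rewrite value_digits ?trunc_log_ltn.
Qed.

(** * Cycles of the involution of a bitonic permutation *)

(** All that the cycle argument needs to know about [bitonic_perm w]. With [N = n.*2.+1], the index
    [n.*2.+2 - i] is [N + 1 - i], the position paired with [i]. *)
Record bitonic_form (n : nat) (q : seq nat) : Prop := BitonicForm {
  bitonic_perm_eq : perm_eq q (iota 1 n.*2.+1);
  bitonic_tail : forall i, 0 < i <= n -> entry 0 q (n.*2.+2 - i) = i }.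

Section Cycles.
Variables (n : nat) (q : seq nat).
Hypothesis q_form : bitonic_form n q.

Let N := n.*2.+1.
Let p := involution_of q.
Let m := entry 0 q n.+1.

Lemma bitonic_size : size q = N.
Proof. by rewrite (perm_size (bitonic_perm_eq q_form)) size_iota. Qed.

Lemma bitonic_entryP i : 0 < i <= N -> 0 < entry 0 q i <= N.
Proof.
case: i => // i lt_i; have := mem_nth 0 (_ : i < size q).
rewrite bitonic_size => /(_ lt_i).
by rewrite (perm_mem (bitonic_perm_eq q_form)) mem_iota.
Qed.

Lemma bitonic_entry_inj i j : 0 < i <= N -> 0 < j <= N ->
  entry 0 q i = entry 0 q j -> i = j.
Proof.
case: i j => // i [] // j lt_i lt_j; rewrite /entry /= => /eqP.
rewrite nth_uniq ?bitonic_size //.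
  by move/eqP->.
by rewrite (perm_uniq (bitonic_perm_eq q_form)) iota_uniq.
Qed.

Lemma bitonic_entry_surj v : 0 < v <= N -> exists2 i, 0 < i <= N & entry 0 q i = v.
Proof.
move=> vP; have : v \in q by rewrite (perm_mem (bitonic_perm_eq q_form)) mem_iota.
by move=> v_q; exists (index v q).+1;
  rewrite -?bitonic_size ?index_mem ?/entry ?nth_index.
Qed.

(** The values up to [n] are all taken by the last [n] positions, so injectivity excludes them from
    the others. *)
Lemma bitonic_head_gt i : 0 < i <= n.+1 -> n < entry 0 q i.
Proof.
move=> iP; rewrite ltnNge; apply/negP => le_n.
have vP : 0 < entry 0 q i <= N by apply: bitonic_entryP; rewrite /N; lia.
have := @bitonic_entry_inj i (n.*2.+2 - entry 0 q i).
rewrite bitonic_tail //; rewrite /N in vP *; lia.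
Qed.

Lemma involution_entry i : 0 < i <= N ->
  entry 0 p (entry 0 q i) = entry 0 q (N.+1 - i).
Proof.
rewrite -bitonic_size => iP; apply: involution_of_cycles => //.
by rewrite bitonic_size (bitonic_perm_eq q_form).
Qed.

Lemma involution_entryP a : 0 < a <= N -> 0 < entry 0 p a <= N.
Proof.
move=> /bitonic_entry_surj[i iP <-]; rewrite involution_entry //.
by apply: bitonic_entryP; lia.
Qed.

Lemma involution_small a : 0 < a <= n -> entry 0 p a = entry 0 q a.
Proof.
move=> aP; rewrite -{1}(bitonic_tail q_form aP) involution_entry; last by rewrite /N; lia.
by congr (entry 0 q _); rewrite /N; lia.
Qed.

Lemma involution_middle : entry 0 p m = m.
Proof. by rewrite involution_entry /N; [congr (entry 0 q _)|]; lia. Qed.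

(** A value [a > n] other than [m] sits at some position [i <= n], since later positions past the
    middle hold values up to [n]. Its partner is then the entry at [N + 1 - i], which is [i < a]. *)
Lemma involution_ge a : 0 < a <= N -> (a <= entry 0 p a) = (a <= n) || (a == m).
Proof.
move=> aP; have [le_an | lt_na] := leqP a n.
  by rewrite involution_small; [have := @bitonic_head_gt a|]; lia.
have [i iP def_a] := bitonic_entry_surj aP.
have [-> | ne_am] /= := eqVneq a m; first by rewrite involution_middle leqnn.
have lt_in : i <= n.
  have ne_in : i != n.+1 by apply: contra_neq ne_am => eq_in; rewrite -def_a eq_in.
  rewrite leqNgt; apply/negP => lt_ni.
  have := @bitonic_tail _ _ q_form (n.*2.+2 - i).
  by rewrite subKn; rewrite /N in iP; lia.
rewrite -def_a involution_entry //.
rewrite (bitonic_tail q_form); last by lia.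
have := @bitonic_head_gt i; lia.
Qed.

Lemma bitonic_middle_bound : n < m <= N.
Proof.
by rewrite bitonic_head_gt ?ltnSn //; have := @bitonic_entryP n.+1; rewrite /N; lia.
Qed.

Lemma cycle_leaders : [seq a <- iota 1 N | a <= entry 0 p a] = rcons (iota 1 n) m.
Proof.
have mP := bitonic_middle_bound.
rewrite (eq_in_filter (a2 := fun a => (a <= n) || (a == m))); last first.
  by move=> a; rewrite mem_iota => aP; apply: involution_ge.
have -> : N = n + n.+1 by rewrite /N; lia.
rewrite iotaD filter_cat -cats1; congr (_ ++ _).
  by apply/all_filterP/allP => a; rewrite mem_iota; lia.
rewrite (eq_in_filter (a2 := pred1 m)); last first.
  by move=> a; rewrite mem_iota /=; lia.
by rewrite filter_pred1_uniq ?iota_uniq // mem_iota; rewrite /N in mP; lia.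
Qed.

Lemma increasing_cyclesE : increasing_cycles p =
  rcons [seq [:: a; entry 0 q a] | a <- iota 1 n] [:: m].
Proof.
rewrite /increasing_cycles size_map size_iota bitonic_size cycle_leaders.
rewrite map_rcons involution_middle eqxx; congr rcons.
apply/eq_in_map => a; rewrite mem_iota => aP.
by rewrite involution_small ?ifF //; have := @bitonic_head_gt a; lia.
Qed.

(* The array after [k] 2-cycles, each of which fills one cell at either end. *)
Definition unfolded (k : nat) : seq nat :=
  table N (fun i => if (i <= k) || (N - k < i) then entry 0 q i else 0).

Lemma unfolded0 : unfolded 0 = nseq N 0.
Proof. by rewrite nseq_table; apply: eq_table => i iP; rewrite ifF //; lia. Qed.

(** The larger element goes to its own position [k.+1]; the leader [k.+1] is what [q] has at
    [N - k], by [bitonic_tail]. *)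
Lemma unfoldedS k : k < n ->
  set_entry (set_entry (unfolded k) k.+1 (entry 0 q k.+1)) (N - k) k.+1
  = unfolded k.+1.
Proof.
move=> lt_kn; rewrite !set_entry_table; try by rewrite /N; lia.
apply: eq_table => i iP; have [->|ne_i] := eqVneq i (N - k).
  rewrite ifT; last by rewrite /N; lia.
  rewrite -(@bitonic_tail _ _ q_form k.+1); last by lia.
  by congr entry; rewrite /N; lia.
have [->|ne_ik] := eqVneq i k.+1; first by rewrite leqnn.
by congr (if _ then _ else _); lia.
Qed.

(** After [n] 2-cycles only the middle cell is still empty. *)
Lemma unfolded_middle : set_entry (unfolded n) n.+1 m = q.
Proof.
rewrite [RHS]table_entry bitonic_size set_entry_table; last by rewrite /N; lia.
apply: eq_table => i iP; have [->//|ne_i] := eqVneq i n.+1.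
by rewrite ifT // /N; lia.
Qed.

Lemma unfold_involution : unfold_cycles N (increasing_cycles p) = q.
Proof.
have step k : k <= n ->
    foldl process_cycle (1, N, nseq N 0)
      [seq [:: a; entry 0 q a] | a <- iota 1 k] = (k.+1, N - k, unfolded k).
  elim: k => [|k IHk] lt_kn; first by rewrite /= unfolded0 subn0.
  rewrite -[X in iota 1 X]addn1 iotaD map_cat foldl_cat IHk 1?ltnW //= add1n unfoldedS //.
  by rewrite -subnS.
rewrite /unfold_cycles increasing_cyclesE foldl_rcons step //=.
exact: unfolded_middle.
Qed.

End Cycles.

(** * Zeros and ones of the encoded bit string *)

Lemma positions_of_cat c (s1 s2 : seq bool) :
  positions_of c (s1 ++ s2) =
  positions_of c s1 ++ [seq size s1 + i | i <- positions_of c s2].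
Proof.
rewrite /positions_of size_cat iotaD filter_cat; congr (_ ++ _).
  apply: eq_in_filter => i; rewrite mem_iota => iP.
  by rewrite /entry nth_cat ifT //; lia.
rewrite addnC iotaDl filter_map; congr map; apply: eq_in_filter => i.
rewrite mem_iota => iP /=; rewrite /entry nth_cat ifF; last by lia.
by congr (nth _ _ _ == _); lia.
Qed.

Lemma positions_of_nseq c d k :
  positions_of c (nseq k d) = if d == c then iota 1 k else [::].
Proof.
rewrite /positions_of size_nseq.
rewrite (eq_in_filter (a2 := fun=> d == c)); last first.
  by move=> i; rewrite mem_iota /entry nth_nseq => iP; rewrite ifT //; lia.
by case: (d == c); rewrite ?filter_predT ?filter_pred0.
Qed.

Lemma increasing_run_take k (s : seq nat) : 0 < k < size s ->
  (forall i, 0 < i < k -> entry 0 s i < entry 0 s i.+1) ->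
  entry 0 s k.+1 < entry 0 s k -> increasing_run s = take k s.
Proof.
elim: k s => // k IHk [|x [|y s]] //= lt_ks up down.
case: k IHk lt_ks up down => [|k] IHk lt_ks up down.
  by rewrite ifF //; apply/negbTE; rewrite -leqNgt ltnW.
rewrite (up 1) //; congr cons; apply: (IHk (y :: s)) => // -[//|i] iP.
by have := up i.+2; apply.
Qed.

Section Encoding.
Variable w : nat.

Let n := size (binary w).
Let N := n.*2.+1.
Let X := positions_of false (encode_bits w).
Let Y := positions_of true (encode_bits w).
Let q := bitonic_perm w.

Lemma bitonic_permE : q = X ++ rev Y.
Proof. by []. Qed.

Lemma encode_bitsE :
  encode_bits w = nseq n true ++ flip (binary w) ++ nseq 1 false.
Proof. by rewrite /encode_bits /flip !map_cat map_nseq. Qed.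

(** The final 1 appended by the encoding becomes the last zero after the flip. *)
Lemma zeros_last : exists X', X = rcons X' N.
Proof.
rewrite /X encode_bitsE !positions_of_cat !positions_of_nseq /= map_cat.
rewrite cats1 !size_nseq size_map -/n; eexists; congr rcons; rewrite /N; lia.
Qed.

(** The padding [0^n] flips to [n] leading ones; reversing [Y] turns them into the tail required by
    [bitonic_form]. *)
Lemma ones_first : exists Y', Y = iota 1 n ++ Y'.
Proof. by rewrite /Y encode_bitsE !positions_of_cat positions_of_nseq; eexists. Qed.

Lemma bitonic_perm_form : bitonic_form n q.
Proof.
have q_perm := bitonic_perm_perm w; rewrite size_encode_bits in q_perm.
split=> // i iP; have [Y' defY] := ones_first.
have szq : size (X ++ rev Y') = n.+1.
  move/perm_size: q_perm; rewrite -/q bitonic_permE defY !(size_cat, size_rev) /=.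
  by rewrite !size_iota -/n; lia.
rewrite bitonic_permE defY rev_cat catA /entry nth_cat szq ifF; last by lia.
by rewrite nth_rev ?size_iota ?nth_iota; lia.
Qed.

Lemma size_zeros : 0 < size X <= n.+1.
Proof.
have [X' defX] := zeros_last; have [Y' defY] := ones_first.
have := size_bitonic_perm w; rewrite -/q bitonic_permE {1}defY defX.
by rewrite size_cat size_rev size_cat size_iota size_rcons -/n; lia.
Qed.

Lemma bitonic_increasing i : 0 < i < size X -> entry 0 q i < entry 0 q i.+1.
Proof.
case: i => // i /andP[_ lt_iX]; rewrite bitonic_permE /entry /=.
rewrite !nth_cat lt_iX (ltnW lt_iX).
have X_sorted : sorted ltn X := sorted_filter ltn_trans _ (iota_ltn_sorted _ _).
by apply: (sorted_ltn_nth ltn_trans 0 X_sorted); rewrite ?inE // (ltnW lt_iX).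
Qed.

(** The last entry of [X] is the maximum [N], so by injectivity any other entry is smaller.
    Positivity of [n] gives [size X <= n.+1 < N], so a next entry exists. *)
Lemma bitonic_descent : 0 < n -> entry 0 q (size X).+1 < entry 0 q (size X).
Proof.
move=> n_gt0; have [X' defX] := zeros_last; have form := bitonic_perm_form.
have szX := size_zeros; have qX : entry 0 q (size X) = N.
  rewrite bitonic_permE defX /entry size_rcons nth_cat size_rcons ltnSn.
  by rewrite nth_rcons ltnn eqxx.
have := bitonic_entryP form (i := (size X).+1).
have := bitonic_entry_inj form (i := (size X).+1) (j := size X).
rewrite qX -/N; rewrite /N in szX *; lia.
Qed.

Lemma increasing_run_bitonic : 0 < n -> increasing_run q = X.
Proof.
move=> n_gt0; have [X_gt0 le_Xn] := andP size_zeros.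
rewrite (increasing_run_take (k := size X)) ?bitonic_permE ?take_size_cat //.
- by rewrite X_gt0 -bitonic_permE size_bitonic_perm -/n; lia.
- exact: bitonic_increasing.
- exact: bitonic_descent.
Qed.

Lemma mem_ones i : 0 < i <= N ->
  (i \in drop (size X) q) = entry false (encode_bits w) i.
Proof.
move=> iP; rewrite bitonic_permE drop_size_cat // mem_rev mem_filter.
by rewrite mem_iota size_encode_bits -/n -/N eqb_id iP andbT.
Qed.

Lemma decode_bits_bitonic : 0 < n -> decode_bits q = encode_bits w.
Proof.
move=> n_gt0; rewrite /decode_bits increasing_run_bitonic // size_bitonic_perm.
apply: (@eq_from_nth _ false); rewrite size_map size_iota ?size_encode_bits //.
move=> j lt_j; rewrite (nth_map 0) ?size_iota // nth_iota //.
exact: mem_ones.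
Qed.

End Encoding.

(** Flipping twice restores [0^n ++ B ++ 1], whose middle block is cut out by [drop n] and
    [take n]. *)
Lemma decode_encode w : decode_SIP_to_W (encode_W_to_SIP w) = w.
Proof.
have n_gt0 : 0 < size (binary w) by rewrite size_binary.
rewrite /decode_SIP_to_W size_encode unfold_involution; last exact: bitonic_perm_form.
rewrite decode_bits_bitonic // /encode_bits /flip (mapK negbK).
rewrite drop_size_cat ?size_nseq /= ?uphalf_double //.
by rewrite take_size_cat // binary_valueK.
Qed.

(** * Symbolic execution on the word RAM *)

Fixpoint value (s : state) (e : expr) : nat :=
  match e with
  | Lit v => v
  | Var x => get_reg s x
  | Length a => size (get_arr s a)
  | Read a e => entry 0 (get_arr s a) (value s e)
  | Half e => (value s e)./2
  | Op o e1 e2 => op_eval o (value s e1) (value s e2)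
  | AndThen e1 e2 => if value s e1 == 0 then 0 else value s e2
  end.

(** A state-independent upper bound: a lazy conjunction may stop early. *)
Fixpoint eval_time (e : expr) : nat :=
  match e with
  | Lit _ | Var _ | Length _ => 1
  | Read _ e | Half e => (eval_time e).+1
  | Op _ e1 e2 | AndThen e1 e2 => (eval_time e1 + eval_time e2).+1
  end.

(** Boolean test that [eval] does not get stuck; the trailing conjunct checks the word bound at
    every subexpression. *)
Fixpoint safe (W : nat) (s : state) (e : expr) : bool :=
  match e with
  | Lit _ | Var _ | Length _ => true
  | Read a e => safe W s e && (0 < value s e <= size (get_arr s a))
  | Half e => safe W s e
  | Op _ e1 e2 => safe W s e1 && safe W s e2
  | AndThen e1 e2 => safe W s e1 && ((value s e1 == 0) || safe W s e2)
  end && (value s e < W).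

Lemma eval_safe W s e : safe W s e ->
  exists2 t, eval W s e = Some (value s e, t) & t <= eval_time e.
Proof.
have wordE v t : v < W -> word W v t = Some (v, t) by rewrite /word => ->.
elim: e => [v|x|a|a e IHe|e IHe|o e1 IH1 e2 IH2|e1 IH1 e2 IH2] /=.
1-3: by move=> lt_vW; exists 1; rewrite ?wordE.
- case/andP=> /andP[/IHe[t -> le_t] ->] lt_vW.
  by rewrite wordE //; exists t.+1.
- by case/andP=> /IHe[t -> le_t] lt_vW; rewrite wordE //; exists t.+1.
- case/andP=> /andP[/IH1[t1 -> le_t1] /IH2[t2 -> le_t2]] lt_vW.
  by rewrite wordE //; exists (t1 + t2).+1; rewrite // ltnS leq_add.
case/andP=> /andP[/IH1[t1 -> le_t1]]; case: eqP => /= [_ _ W_gt0 | _].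
  by rewrite wordE //; exists t1.+1; rewrite // ltnS (leq_trans le_t1) ?leq_addr.
case/IH2=> t2 -> le_t2 lt_vW.
by rewrite wordE //; exists (t1 + t2).+1; rewrite // ltnS leq_add.
Qed.

(* [result] and [straight_time] are meaningful only for the commands without
   loops and allocations, the others being rejected by [straight_safe]. *)
Fixpoint result (s : state) (c : cmd) : state :=
  match c with
  | Assign x e => set_reg s x (value s e)
  | Write a e1 e2 => set_arr s a (set_entry (get_arr s a) (value s e1) (value s e2))
  | Seq c1 c2 => result (result s c1) c2
  | If e c1 c2 => if value s e == 0 then result s c2 else result s c1
  | _ => s
  end.

Fixpoint straight_time (c : cmd) : nat :=
  match c with
  | Assign _ e => (eval_time e).+1
  | Write _ e1 e2 => (eval_time e1 + eval_time e2).+1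
  | Seq c1 c2 => straight_time c1 + straight_time c2
  | If e c1 c2 => (eval_time e + maxn (straight_time c1) (straight_time c2)).+1
  | _ => 1
  end.

Fixpoint straight_safe (W : nat) (s : state) (c : cmd) : bool :=
  match c with
  | Skip => true
  | Assign _ e => safe W s e
  | Write a e1 e2 =>
      [&& safe W s e1, safe W s e2 & 0 < value s e1 <= size (get_arr s a)]
  | Seq c1 c2 => straight_safe W s c1 && straight_safe W (result s c1) c2
  | If e c1 c2 =>
      safe W s e && (if value s e == 0 then straight_safe W s c2
                     else straight_safe W s c1)
  | _ => false
  end.

(** The space is left out because [exec_space] recovers a bound on it from the time. *)
Definition runs (W : nat) (c : cmd) (s s' : state) (T : nat) : Prop :=
  exists t m, exec W c s s' t m /\ t <= T.

Lemma runs_straight W c s : straight_safe W s c ->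
  runs W c s (result s c) (straight_time c).
Proof.
elim: c s => [|x e|a e|a e1 e2|c1 IH1 c2 IH2|e c1 IH1 c2 IH2|e c IHc] s //=.
- by move=> _; exists 1, (space s); split=> //; constructor.
- by case/eval_safe=> t ev le_t; do 2!eexists; split; [apply: ExecAssign ev|].
- case/and3P=> /eval_safe[t1 ev1 le_t1] /eval_safe[t2 ev2 le_t2] iP.
  by do 2!eexists; split; [apply: ExecWrite ev1 ev2 iP | rewrite ltnS leq_add].
- case/andP=> /IH1[t1 [m1 [ex1 le_t1]]] /IH2[t2 [m2 [ex2 le_t2]]].
  by do 2!eexists; split; [apply: ExecSeq ex1 ex2 | rewrite leq_add].
case/andP=> /eval_safe[t ev le_t].
have -> : (if value s e == 0 then result s c2 else result s c1)
  = result s (if value s e == 0 then c2 else c1) by case: ifP.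
case: ifP => vE => [/IH2 | /IH1] [t' [m [ex le_t']]].
  do 2!eexists; split; [by apply: ExecIf ev _; rewrite vE; apply: ex|].
  by rewrite ltnS leq_add // leq_max le_t' orbT.
do 2!eexists; split; [by apply: ExecIf ev _; rewrite vE; apply: ex|].
by rewrite ltnS leq_add // leq_max le_t'.
Qed.

Lemma runs_seq W c1 c2 s s1 s2 T1 T2 :
  runs W c1 s s1 T1 -> runs W c2 s1 s2 T2 -> runs W (Seq c1 c2) s s2 (T1 + T2).
Proof.
move=> [t1 [m1 [ex1 le1]]] [t2 [m2 [ex2 le2]]].
by do 2!eexists; split; [apply: ExecSeq ex1 ex2 | rewrite leq_add].
Qed.

Lemma runs_le W c s s' T T' : runs W c s s' T -> T <= T' -> runs W c s s' T'.
Proof. by move=> [t [m [ex le]]] /(leq_trans le) le'; exists t, m. Qed.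

Lemma runs_alloc W a e s : safe W s e ->
  runs W (Alloc a e) s (set_arr s a (nseq (value s e) 0)) (eval_time e + value s e).+1.
Proof.
case/eval_safe=> t ev le_t; do 2!eexists; split; [exact: ExecAlloc ev|].
by rewrite ltnS leq_add2r.
Qed.

(** [st v] is the exact state before iteration [v]; the family [st] plays the role of the loop
    invariant. *)
Lemma runs_while W e c (st : nat -> state) lo hi :
  lo <= hi ->
  (forall v, lo <= v < hi ->
    [/\ safe W (st v) e, value (st v) e != 0, straight_safe W (st v) c
      & result (st v) c = st v.+1]) ->
  safe W (st hi) e -> value (st hi) e = 0 ->
  runs W (While e c) (st lo) (st hi)
    ((hi - lo) * (eval_time e + straight_time c).+1 + (eval_time e).+1).
Proof.
move=> le_lohi body safe_hi value_hi; rewrite -(subKn le_lohi).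
(* Induction on the number [k] of remaining iterations, started from [st (hi - k)]; the second
   occurrence of [hi - lo] stays as the bound on [k]. *)
have: hi - lo <= hi - lo by []; move: {1 3 4}(hi - lo) => k.
elim: k => [_|k IHk lt_k].
  have [t ev le_t] := eval_safe safe_hi; rewrite value_hi in ev.
  by rewrite subn0 subnn; do 2!eexists; split; [apply: ExecWhileEnd ev|].
have [] := body (hi - k.+1); first by lia.
move=> /eval_safe[t0 ev le0] nz /runs_straight[t1 [m1 [ex1 le1]]] step.
have eq_k : (hi - k.+1).+1 = hi - k by lia.
rewrite step eq_k in ex1; have [t2 [m2 [ex2 le2]]] := IHk (ltnW lt_k).
do 2!eexists; split; [exact: ExecWhileStep ev nz ex1 ex2|].
rewrite subKn in le2; last by lia.
by rewrite subKn ?mulSn; lia.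
Qed.

(** The counter reaches [hi.+1] when the guard fails, hence the bound [hi.+1 < W]. The constant 7
    pays for the guard (2 beyond [e2]), the increment (4) and the loop step (1). *)
Lemma runs_for W x e1 e2 c s (st : nat -> state) hi :
  safe W s e1 -> value s e1 <= hi.+1 < W ->
  set_reg s x (value s e1) = st (value s e1) ->
  (forall v, value s e1 <= v <= hi.+1 ->
    [/\ get_reg (st v) x = v, safe W (st v) e2 & value (st v) e2 = hi]) ->
  (forall v, value s e1 <= v <= hi ->
    straight_safe W (st v) (c ;; x ::= x + 1)%ram /\
    result (st v) (c ;; x ::= x + 1)%ram = st v.+1) ->
  runs W (For x e1 e2 c) s (st hi.+1)
    ((eval_time e1).+1 +
     ((hi.+1 - value s e1) * (eval_time e2 + straight_time c + 7)
      + (eval_time e2).+3)).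
Proof.
move=> safe1 /andP[le_lo lt_W] init bound body.
apply: runs_seq (runs_straight (c := Assign x e1) safe1) _; rewrite /= init.
have guard v : value s e1 <= v <= hi.+1 -> safe W (st v) (x <= e2)%ram.
  by move=> vP; have [/= -> -> ->] := bound v vP; rewrite andbT /=; lia.
apply: runs_le (@runs_while W _ _ st _ hi.+1 le_lo _ _ _) _.
- move=> v vP; have vP' : value s e1 <= v <= hi by lia.
  have [|vx _ v2] := bound v; first by lia.
  have [? ?] := body v vP'; split=> //; first by apply: guard; lia.
  by rewrite /= vx v2; lia.
- by apply: guard; rewrite le_lo leqnn.
- by have [|/= -> _ ->] := bound hi.+1; rewrite ?le_lo ?leqnn ?ltnn.
by rewrite /=; lia.
Qed.

(** * Space bounded by time *)

(** Assigning [Reg k] may extend the register list to length [k.+1], so bounding the indices bounds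
    the growth at one assignment. *)
Fixpoint regs_below (K : nat) (c : cmd) : bool :=
  match c with
  | Assign x _ => reg_id x < K
  | Seq c1 c2 | If _ c1 c2 => regs_below K c1 && regs_below K c2
  | While _ c => regs_below K c
  | _ => true
  end.

Lemma space_set_arr s a t :
  space (set_arr s a t) + size (get_arr s a) = space s + size t.
Proof.
suff: sumn (map size (set_nth [::] (arrs s) (arr_id a) t)) + size (get_arr s a)
    = sumn (map size (arrs s)) + size t by rewrite /space /set_arr /=; lia.
rewrite /get_arr; elim: (arrs s) (arr_id a) => [|u ss IHss] [|i] /=; try lia.
  by elim: i => [|i IHi] /=; lia.
by have := IHss i; lia.
Qed.

(** The final space is bounded together with [m] because in [Seq] and [While] it is where the next
    command starts. *)
Lemma exec_space K W c s s' t m : 0 < K -> regs_below K c ->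
  exec W c s s' t m -> maxn m (space s') <= space s + K * t.
Proof.
move=> K_gt0 + ex; elim: ex => {c s s' t m} /=.
- by move=> s _; rewrite maxnn leq_addr.
- move=> [x] e s v t _ /= lt_xK; rewrite mulnS /space /= size_set_nth; lia.
- move=> a e s v t _ _; have := space_set_arr s a (nseq v 0).
  by rewrite size_nseq; have := leq_pmull (t + v).+1 K_gt0; lia.
- move=> a e1 e2 s i v t1 t2 _ _ iP _.
  have := space_set_arr s a (set_entry (get_arr s a) i v).
  rewrite size_set_nth mulnS; lia.
- move=> c1 c2 s s1 s2 t1 t2 m1 m2 _ IH1 _ IH2 /andP[/IH1 + /IH2]; lia.
- move=> e c1 c2 s s' v t t' m _ _ IH /andP[K1 K2].
  have : regs_below K (if v == 0 then c2 else c1) by case: ifP.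
  by move=> /IH; rewrite mulnS mulnDr; lia.
- by move=> e c s t _ _; rewrite maxnn leq_addr.
move=> e c s s1 s2 v t t1 t2 m1 m2 _ _ _ IH1 _ IH2 Kc.
by have := IH1 Kc; have := IH2 Kc; rewrite mulnS !mulnDr; lia.
Qed.

(** * The decoding program *)

Definition prefix_table (N : nat) (f : nat -> nat) (k : nat) : seq nat :=
  table N (fun i => if i <= k then f i else 0).

Lemma size_prefix_table N f k : size (prefix_table N f k) = N.
Proof. exact: size_table. Qed.

Lemma prefix_table0 N f : prefix_table N f 0 = nseq N 0.
Proof. by rewrite nseq_table; apply: eq_table => -[]. Qed.

Lemma set_entry_prefix N f k v : k < N -> v = f k.+1 ->
  set_entry (prefix_table N f k) k.+1 v = prefix_table N f k.+1.
Proof.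
move=> lt_kN ->; rewrite set_entry_table //; apply: eq_table => i _.
by have [->|ne_i] := eqVneq i k.+1; rewrite ?leqnn // [in RHS]leq_eqVlt (negPf ne_i).
Qed.

Lemma entry_prefix N f k i : 0 < i <= k -> k <= N -> entry 0 (prefix_table N f k) i = f i.
Proof. by move=> iP le_kN; rewrite entry_table ?ifT //; lia. Qed.

Section Decoding.
Variables (W w : nat).
Let n := size (binary w).
Variable N : nat.
Hypothesis defN : N = n.*2.+1.
Let q := bitonic_perm w.
Let p := encode_W_to_SIP w.
Let m := entry 0 q n.+1.
Hypothesis lt_NW : N.+2 < W.

Let form : bitonic_form n q := bitonic_perm_form w.
Let size_p : size p = N. Proof. by rewrite defN size_encode. Qed.
Let size_q : size q = N. Proof. by rewrite defN size_bitonic_perm. Qed.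
Let n_gt0 : 0 < n. Proof. by rewrite /n size_binary. Qed.

(* [found v] is the number of cycles with leader below [v]. *)
Let leader (l : nat) := if l <= n then l else m.
Let found (v : nat) := minn v.-1 n + (m < v).

(* States list the registers N, n, a, cycles, l, i, j, k, r and the arrays
   P, Out, First, Second, Q, Bs, C, up to the last one used so far. *)
Let cycles_state (v : nat) : state :=
  State [:: N; n; v; found v]
        [:: p; [::]; prefix_table N leader (found v);
         prefix_table N (entry 0 q) (found v)].

Let mP : n < m <= N. Proof. by rewrite defN; apply: (bitonic_middle_bound form). Qed.

Let p_entryP v : 0 < v <= N -> 0 < entry 0 p v <= N.
Proof. by rewrite defN; apply: (involution_entryP form). Qed.

Let q_entryP v : 0 < v <= N -> 0 < entry 0 q v <= N.
Proof. by rewrite defN; apply: (bitonic_entryP form). Qed.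

(** Before a leader [v <= n] exactly [v.-1] cycles are known, and before [m] exactly [n]. The larger
    element of the [l]-th cycle is [entry 0 q l] even for the fixed point, because [m] is the entry
    at [n.+1]. *)
Let found_step v : 0 < v <= N ->
  if (v <= n) || (v == m) then
    [/\ found v.+1 = (found v).+1, found v < N, v = leader (found v).+1
      & entry 0 p v = entry 0 q (found v).+1]
  else found v.+1 = found v.
Proof.
rewrite /found /leader => vP; have [le_vn | lt_nv] := leqP v n; rewrite /=.
  have -> : minn v.-1 n + (m < v) = v.-1 by lia.
  rewrite prednK; last by lia.
  split; rewrite ?le_vn //; try lia.
  by apply: (involution_small form); lia.
have [-> | ne_vm] := eqVneq v m; last by lia.
have -> : minn m.-1 n + (m < m) = n by lia.
split; rewrite ?ltnn //; try lia.
by rewrite (involution_middle form).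
Qed.

Lemma runs_cycles :
  runs W prog_cycles (State [:: N; n] [:: p]) (cycles_state N.+1) (60 * N).
Proof.
apply: runs_le.
  apply: runs_seq; first by apply: runs_alloc; rewrite /= /get_reg /=; lia.
  apply: runs_seq; first by apply: runs_alloc; rewrite /= /get_reg /=; lia.
  apply: runs_seq; first by apply: runs_straight; rewrite /=; lia.
  apply: (@runs_for _ _ _ _ _ _ cycles_state).
  - by rewrite /=; lia.
  - by rewrite /=; lia.
  - have f1 : found 1 = 0 by rewrite /found; lia.
    by rewrite /cycles_state /= f1 !prefix_table0.
  - by move=> v vP; split=> //=; rewrite /get_reg /=; lia.
  move=> v /= vP; have p_v := p_entryP vP.
  have ge_p : (v <= entry 0 p v) = (v <= n) || (v == m).
    by apply: (involution_ge form); rewrite -defN.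
  have := found_step vP; rewrite /get_reg /get_arr /set_arr /set_reg /= ge_p.
  case: (_ || _) => /= [[eq_f lt_f def_v def_pv] | eq_f].
    rewrite !addn1 !size_prefix_table size_p; split; first by lia.
    by rewrite /cycles_state eq_f !set_entry_prefix.
  rewrite !addn1 size_p; split; first by lia.
  by rewrite /cycles_state eq_f.
by rewrite /= /get_reg /=; lia.
Qed.

(** * Unfolding the cycles in memory *)

Let leaders := prefix_table N leader n.+1.
Let partners := prefix_table N (entry 0 q) n.+1.

Let unfold_array (v : nat) : seq nat := if v <= n.+1 then unfolded n q v.-1 else q.

(** Every cycle advances [i], which thus equals [l]; the fixed point, processed last, leaves [j]
    alone, hence the [minn]. *)
Let unfold_state (v : nat) : state :=
  State [:: N; n; N.+1; n.+1; v; v; N - minn v.-1 n]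
        [:: p; [::]; leaders; partners; unfold_array v].

Let size_unfold_array v : size (unfold_array v) = N.
Proof. by rewrite /unfold_array; case: ifP; rewrite // size_table defN. Qed.

Lemma runs_unfold :
  runs W prog_unfold (cycles_state N.+1) (unfold_state n.+2) (60 * N).
Proof.
have -> : cycles_state N.+1 = State [:: N; n; N.+1; n.+1] [:: p; [::]; leaders; partners].
  rewrite /cycles_state /leaders /partners.
  by have -> : found N.+1 = n.+1 by rewrite /found /=; lia.
apply: runs_le.
  apply: runs_seq; first by apply: runs_alloc; rewrite /= /get_reg /=; lia.
  apply: runs_seq; first by apply: runs_straight; rewrite /=; lia.
  apply: runs_seq; first by apply: runs_straight; rewrite /= /get_reg /=; lia.
  apply: (@runs_for _ _ _ _ _ _ unfold_state).
  - by rewrite /=; lia.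
  - by rewrite /= /get_reg /=; lia.
  - rewrite /unfold_state /unfold_array /= /get_reg /= (unfolded0 n) -defN.
    by rewrite min0n subn0.
  - by move=> v vP; split=> //=; rewrite /get_reg /=; lia.
  move=> v /= vP; have q_v := q_entryP (v := v).
  have eF : entry 0 leaders v = leader v by rewrite entry_prefix; lia.
  have eS : entry 0 partners v = entry 0 q v by rewrite entry_prefix; lia.
  have head_v := @bitonic_head_gt _ _ form v.
  have sU := size_unfold_array v.
  rewrite /get_reg /get_arr /set_arr /set_reg /= eF eS !size_prefix_table sU.
  (* The program's test recognises 2-cycles since [v <= n < entry 0 q v]; at [v = n.+1] both stored
     elements are [m] and it fails. *)
  have [le_vn | lt_nv] := leqP v n; rewrite /leader.
    rewrite le_vn; have -> : v < entry 0 q v by lia.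
    rewrite /= !addn1 size_set_nth sU; split; first by lia.
    have := @unfoldedS _ _ form v.-1; rewrite prednK; last by lia.
    move=> unf; rewrite /unfold_state /unfold_array ltnS le_vn leqW //= -unf; last by lia.
    congr (State [:: _; _; _; _; _; _; _] [:: _; _; _; _; _]).
      by lia.
    by rewrite -defN; congr set_entry; lia.
  have -> : v = n.+1 by lia.
  rewrite ltnn -/m ltnn /= !addn1 /=; split; first by lia.
  rewrite /unfold_state /unfold_array ltnn leqnn /= (unfolded_middle form).
  by rewrite minnn (minn_idPr (leqnSn n)).
by rewrite /= /get_reg /=; lia.
Qed.

(** * Finding the increasing run *)

Let k := size (positions_of false (encode_bits w)).
Let kP : 0 < k <= n.+1 := size_zeros w.

Let run_state (v : nat) : state :=
  State [:: N; n; N.+1; n.+1; n.+2; n.+2; n.+1; v]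
        [:: p; [::]; leaders; partners; q].

Lemma runs_run : runs W prog_run (unfold_state n.+2) (run_state k) (60 * N).
Proof.
apply: runs_le.
  apply: runs_seq.
    by apply: (runs_straight (c := (Reg 7 ::= 1)%ram)); rewrite /=; lia.
  have -> : result (unfold_state n.+2) (Reg 7 ::= 1)%ram = run_state 1.
    rewrite /unfold_state /unfold_array ltnn /run_state /set_reg /=.
    by congr (State [:: _; _; _; _; _; _; _; _] _); lia.
  apply: (@runs_while _ _ _ run_state 1 k).
  - by case/andP: kP.
  - move=> v vP; have := bitonic_increasing vP; rewrite -/q => up.
    have q_v := q_entryP (v := v); have q_v1 := q_entryP (v := v.+1).
    rewrite /get_reg /get_arr /set_arr /set_reg /= /get_reg /get_arr /= !addn1 size_q up.
    have -> : v < N by lia.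
    by split=> //=; lia.
  (* As [k <= n.+1 < N], the loop ends on the descent and not on the end of the array, so both reads
     are in bounds. *)
  - have q_v := q_entryP (v := k); have q_v1 := q_entryP (v := k.+1).
    rewrite /= /get_reg /get_arr /= !addn1 size_q; have -> /= : k < N by lia.
    by case: ltnP; lia.
  have := bitonic_descent n_gt0; rewrite -/q -/k => down.
  rewrite /= /get_reg /get_arr /= !addn1; case: ifP => // _.
  by rewrite ltnNge ltnW.
by rewrite /=; lia.
Qed.

(** * Building, flipping and returning the bits *)

(** Zeros are written into a zero-filled array, so only the counter changes. *)
Let zeros_state (v : nat) : state :=
  State [:: N; n; N.+1; n.+1; n.+2; n.+2; n.+1; k; v]
        [:: p; [::]; leaders; partners; q; nseq N 0].

(** The slice of [q] from position [k.+1] to [v.-1] lists the cells set to 1 before iteration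
    [v]. *)
Let bits_table (v : nat) : seq nat := table N (fun i => i \in drop k (take v.-1 q)).

Let ones_state (v : nat) : state :=
  State [:: N; n; N.+1; n.+1; n.+2; n.+2; n.+1; k; v]
        [:: p; [::]; leaders; partners; q; bits_table v].

Lemma runs_bits : runs W prog_bits (run_state k) (ones_state N.+1) (60 * N).
Proof.
apply: runs_le.
  apply: runs_seq; first by apply: runs_alloc; rewrite /= /get_reg /=; lia.
  apply: runs_seq.
    apply: (@runs_for _ _ _ _ _ _ zeros_state k).
    - by rewrite /=; lia.
    - by rewrite /=; lia.
    - by [].
    - by move=> v vP; split=> //=; rewrite /get_reg /=; lia.
    move=> v /= vP; have q_v := q_entryP (v := v).
    rewrite /get_reg /get_arr /set_arr /set_reg /= !addn1 size_q size_nseq.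
    split; first by lia.
    rewrite /zeros_state nseq_table set_entry_table; last by lia.
    by congr State; congr [:: _; _; _; _; _; _]; apply: eq_table => i _; case: eqP.
  apply: (@runs_for _ _ _ _ _ _ ones_state N).
  - by rewrite /= /get_reg /=; lia.
  - by rewrite /= /get_reg /=; lia.
  - rewrite /= /get_reg /ones_state /set_reg /= addn1 /bits_table /=.
    rewrite drop_oversize ?size_take_min ?geq_minl // nseq_table.
    by congr State; congr [:: _; _; _; _; _; _]; apply: eq_table.
  - by move=> v vP; split=> //=; rewrite /get_reg /=; lia.
  move=> v /=; rewrite /get_reg /= addn1 => vP; have q_v := q_entryP (v := v).
  rewrite /get_reg /get_arr /set_arr /set_reg /= !addn1 size_q size_table.
  split; first by lia.
  rewrite /ones_state /bits_table set_entry_table; last by lia.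
  congr State; congr [:: _; _; _; _; _; _]; apply: eq_table => i _.
  rewrite -[v in RHS]prednK ?(take_nth 0) ?drop_rcons ?size_take_min; try lia.
  by rewrite mem_rcons in_cons /entry; case: eqP.
by rewrite /= /get_reg /=; lia.
Qed.

Let flipped (i : nat) : nat := 1 - (i \in drop k q).

Let flip_state (v : nat) : state :=
  State [:: N; n; N.+1; n.+1; n.+2; n.+2; n.+1; k; v]
        [:: p; [::]; leaders; partners; q; bits_table N.+1; prefix_table N flipped v.-1].

Lemma runs_flip : runs W prog_flip (ones_state N.+1) (flip_state N.+1) (60 * N).
Proof.
apply: runs_le.
  apply: runs_seq; first by apply: runs_alloc; rewrite /= /get_reg /=; lia.
  apply: (@runs_for _ _ _ _ _ _ flip_state N).
  - by rewrite /=; lia.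
  - by rewrite /=; lia.
  - by rewrite /flip_state prefix_table0.
  - by move=> v vP; split=> //=; rewrite /get_reg /=; lia.
  move=> [|v] //= vP.
  rewrite /get_reg /get_arr /set_arr /set_reg /= !addn1.
  rewrite [size (bits_table _)]size_table size_prefix_table.
  have -> : entry 0 (bits_table N.+1) v.+1 = (v.+1 \in drop k q).
    by rewrite entry_table //= take_oversize ?size_q.
  split; first by lia.
  by rewrite /flip_state set_entry_prefix.
by rewrite /= /get_reg /=; lia.
Qed.

Let return_state (v : nat) : state :=
  State [:: N; n; N.+1; n.+1; n.+2; n.+2; n.+1; k; v]
        [:: p; prefix_table n (fun r => flipped (n + r)) v.-1; leaders; partners; q;
            bits_table N.+1; prefix_table N flipped N].

Lemma runs_return : runs W prog_return (flip_state N.+1) (return_state n.+1) (60 * N).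
Proof.
apply: runs_le.
  apply: runs_seq; first by apply: runs_alloc; rewrite /= /get_reg /=; lia.
  apply: (@runs_for _ _ _ _ _ _ return_state n).
  - by rewrite /=; lia.
  - by rewrite /=; lia.
  - by rewrite /return_state prefix_table0.
  - by move=> v vP; split=> //=; rewrite /get_reg /=; lia.
  move=> [|v] //= vP; have f1 : flipped (n + v.+1) <= 1 by apply: leq_subr.
  rewrite /get_reg /get_arr /set_arr /set_reg /= !addn1 !size_prefix_table.
  rewrite entry_prefix; try lia.
  split; first by lia.
  by rewrite /return_state set_entry_prefix.
by rewrite /= /get_reg /=; lia.
Qed.

(** Cell [j.+1] of the output negates bit [n + j.+1] of [B*]; skipping the [n] leading ones lands on
    digit [j] of [flip (binary w)]. *)
Let return_state_returns : returns (return_state n.+1) w.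
Proof.
rewrite /returns /get_arr /=; apply: (@eq_from_nth _ 0).
  by rewrite size_prefix_table size_map.
rewrite size_prefix_table => j lt_jn; rewrite (nth_map false) //.
rewrite -[LHS]/(entry 0 _ j.+1) entry_prefix // /flipped mem_ones; last by lia.
rewrite encode_bitsE /entry nth_cat size_nseq addnS /= ifF; last by lia.
rewrite addKn nth_cat size_map lt_jn (nth_map false) //.
by case: (nth _ _ _).
Qed.

(** Six phases of [60 * N] each; the remaining [60 * N] covers the computation of [N] and [n]. *)
Lemma runs_decode :
  exists2 s, runs W decode_program (initial_state p) s (420 * N) & returns s w.
Proof.
exists (return_state n.+1); last exact: return_state_returns.
apply: runs_le.
  apply: runs_seq; first by apply: runs_straight; rewrite /= /get_arr /= size_p; lia.
  apply: runs_seq.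
    by apply: runs_straight; rewrite /= /get_arr /get_reg /= size_p; lia.
  have -> : result (result (initial_state p) (Reg 0 ::= Length input_array)%ram)
      (Reg 1 ::= Half (Reg 0))%ram = State [:: N; n] [:: p].
    rewrite /= /get_arr /get_reg /set_reg /= size_p.
    by congr (State [:: _; _] _); lia.
  apply: runs_seq runs_cycles _; apply: runs_seq runs_unfold _.
  apply: runs_seq runs_run _; apply: runs_seq runs_bits _.
  exact: runs_seq runs_flip runs_return.
by rewrite /=; lia.
Qed.

End Decoding.

Theorem theorem2 :
  exists C : nat,
  forall (w N : nat) (p : seq nat),
    0 < w ->
    self_inverting N p ->
    p = encode_W_to_SIP w ->
    decode_SIP_to_W p = w /\
    exists (s : state) (time mem : nat),
      [/\ exec (C * N) decode_program (initial_state p) s time mem,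
          returns s w,
          time <= C * N
        & mem <= C * N].
Proof.
(* Time [420 N] with nine registers gives space at most [N + 9 * 420 N]. *)
exists 4000 => w N p _ [/perm_size szp _] def_p.
split; first by rewrite def_p decode_encode.
have defN : N = (size (binary w)).*2.+1.
  by rewrite -(size_iota 1 N) -szp def_p size_encode.
(* The same constant serves as word bound; [defN] provides [N > 0]. *)
have lt_NW : N.+2 < 4000 * N by lia.
have [s [t [mem [run le_t]]] ret] := runs_decode defN lt_NW.
exists s, t, mem; split=> //; rewrite ?def_p //; first by lia.
have := @exec_space 9 _ decode_program _ _ _ _ isT isT run.
by rewrite /space /= size_encode -defN; lia.
Qed.
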